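(* Let $A\in\Gamma$ be a formal power series of order $n$, and let $\beta_A$ be some Böttcher function of $A$. Then every decomposition $A=A_1\circ A_2\circ\dots\circ A_r$ ($r\ge 2$) of $A$ into a composition of elements $A_1,A_2,\dots,A_r$ of $\Gamma$ is equivalent to the decomposition $$A=(\beta_A\circ z^{\operatorname{ord}A_1})\circ z^{\operatorname{ord}A_2}\circ\dots\circ(z^{\operatorname{ord}A_r}\circ\beta_A^{-1}).$$ Thus, equivalence classes of decompositions of $A$ are in one-to-one correspondence (via $(A_1,\dots,A_r)\mapsto(\operatorname{ord}A_1,\dots,\operatorname{ord}A_r)$) with ordered factorizations $n=n_1n_2\cdots n_r$, $r\ge2$, into integers $n_i\ge 2$.
   Context: $k$ is an algebraically closed field of characteristic zero and $k[[z]]$ is the ring of formal power series over $k$. The order of a nonzero $A=\sum_{n\ge0}c_nz^n$ is $\operatorname{ord}A=\min\{n : c_n\ne0\}$. $k_1[[z]]$ is the set of series of order exactly $1$ (a group under composition $\circ$; inverses $\mu^{-1}$ are compositional), and $\Gamma$ is the set of (nonzero) series of order at least $2$ (a semigroup under $\circ$). A Böttcher function of $A\in\Gamma$ with $\operatorname{ord}A=n$ is an element $\beta_A\in k_1[[z]]$ with $\beta_A^{-1}\circ A\circ\beta_A=z^n$; such functions always exist and are unique up to $\beta_A\mapsto\beta_A\circ\varepsilon z$, $\varepsilon^{n-1}=1$. Two decompositions $A=A_1\circ\dots\circ A_p$ and $A=\widehat A_1\circ\dots\circ\widehat A_q$ into elements of $\Gamma$ ($p,q\ge2$) are equivalent if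 $p=q$ and there exist $\mu_1,\dots,\mu_{p-1}\in k_1[[z]]$ such that $A_1=\widehat A_1\circ\mu_1^{-1}$, $A_i=\mu_{i-1}\circ\widehat A_i\circ\mu_i^{-1}$ for $1<i<p$, and $A_p=\mu_{p-1}\circ\widehat A_p$. *)

(* Defs.v *)
From HB Require Import structures.
From mathcomp Require Import all_boot all_order all_algebra.
From mathcomp Require Import boolp classical_sets functions.

Set Implicit Arguments.
Unset Strict Implicit.
Unset Printing Implicit Defensive.

Import GRing.Theory.
Local Open Scope classical_set_scope.
Local Open Scope ring_scope.

(* A formal power series is its coefficient sequence. *)
Definition fps (K : fieldType) := nat -> K.

Section FormalPowerSeries.
Variable K : fieldType.
Implicit Types A B beta mu nu : fps K.

Definition fps_trunc (n : nat) A : {poly K} := \poly_(i < n.+1) A i.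

(* If B has no constant term, the coefficient of z^n in A(B(z)) only depends
   on the coefficients of index at most n of A and B.  When B 0 != 0 the
   composition is not defined and this is a junk value. *)
Definition fps_comp A B : fps K :=
  fun n => (fps_trunc n A \Po fps_trunc n B)`_n.

Definition fps_Xn (m : nat) : fps K := fun n => (n == m)%:R.

(* The zero series gets the junk order 0. *)
Definition ord A : nat :=
  if pselect (exists n, A n != 0) is left nzA then ex_minn nzA else 0%N.

Definition k1 A : Prop := (exists n, A n != 0) /\ ord A = 1%N.

Definition Gamma A : Prop := (exists n, A n != 0) /\ (2 <= ord A)%N.

Definition is_fps_inv mu nu : Prop :=
  [/\ k1 nu, fps_comp mu nu = fps_Xn 1 & fps_comp nu mu = fps_Xn 1].

(* The compositional inverse in the group k1 (junk outside k1). *)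
Definition fps_inv mu : fps K :=
  if pselect (exists nu, is_fps_inv mu nu) is left invmu
  then projT1 (cid invmu) else fps_Xn 1.

Definition is_boettcher A beta : Prop :=
  k1 beta /\ fps_comp (fps_comp (fps_inv beta) A) beta = fps_Xn (ord A).

Definition fps_comp_seq (s : seq (fps K)) : fps K :=
  foldr fps_comp (fps_Xn 1) s.

Definition decomposition A (s : seq (fps K)) : Prop :=
  [/\ (2 <= size s)%N,
      forall i, (i < size s)%N -> Gamma (nth (fps_Xn 1) s i)
    & fps_comp_seq s = A].

(* Indices are shifted: nth _ s i is A_(i+1) and mu i is mu_(i+1), so with
   p = size s, mu is only relevant on indices 0, ..., p - 2. *)
Definition equiv_decomposition (s t : seq (fps K)) : Prop :=
  let p := size s in
  let S := nth (fps_Xn 1) s in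
  let T := nth (fps_Xn 1) t in
  size s = size t /\
  exists mu : nat -> fps K,
    [/\ forall i, (i < p.-1)%N -> k1 (mu i),
        S 0%N = fps_comp (T 0%N) (fps_inv (mu 0%N)),
        forall i, (0 < i < p.-1)%N ->
          S i = fps_comp (fps_comp (mu i.-1) (T i)) (fps_inv (mu i))
      & S p.-1 = fps_comp (mu p.-2) (T p.-1)].

(* For ns = [:: n_1; ...; n_r] with r >= 2:
   beta o z^n_1, z^n_2, ..., z^n_(r-1), z^n_r o beta^-1. *)
Definition boettcher_decomposition beta (ns : seq nat) : seq (fps K) :=
  mkseq (fun i =>
    let Z := fps_Xn (nth 0%N ns i) in
    if i == 0%N then fps_comp beta Z
    else if i == (size ns).-1 then fps_comp Z (fps_inv beta)
    else Z) (size ns).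

Definition decomposition_class A (s : seq (fps K)) : set (seq (fps K)) :=
  [set t | decomposition A t /\ equiv_decomposition s t].

Definition decomposition_classes A : set (set (seq (fps K))) :=
  [set decomposition_class A s | s in [set s | decomposition A s]].

End FormalPowerSeries.

Definition ordered_factorizations (n : nat) : set (seq nat) :=
  [set ns | [/\ (2 <= size ns)%N, all (leq 2) ns & (\prod_(m <- ns) m)%N = n]].

(* Main.v *)
(* Let beta linearize A, that is, A o beta = beta o z^n.  For C of order m and mu
   of order 1, the equation C o nu = mu o z^m is solvable with nu of order 1, the
   linear coefficient c of nu being any solution of C_m c^m = mu_1.  Peeling off
   the factors A_1, A_2, ... from the left and choosing this coefficient suitably
   at each step produces beta = mu_0, mu_1, ..., mu_r = beta with
   A_i o mu_i = mu_(i-1) o z^(ord A_i).  Two decompositions of A with the same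
   orders therefore share the linear models of their factors, and mu_i o nu_i^-1
   is an equivalence between them. *)
Require Import Defs.
From HB Require Import structures.
From mathcomp Require Import all_boot all_order all_algebra.
From mathcomp Require Import boolp classical_sets functions.
From mathcomp Require Import zify ring.

Set Implicit Arguments.
Unset Strict Implicit.
Unset Printing Implicit Defensive.

(** * Composition of power series through polynomial truncations *)

Section SeriesComposition.
Import GRing.Theory.
Local Open Scope ring_scope.
Variable K : fieldType.
Implicit Types (p q : {poly K}) (A B C X Y : fps K) (m n M k : nat).

Lemma poly_lowE n p : (forall i, (i < n)%N -> p`_i = 0) ->
  p = drop_poly n p * 'X^n.
Proof.
move=> p0; rewrite -[LHS](poly_take_drop n).
suff -> : take_poly n p = 0 by rewrite add0r.
by apply/polyP=> i; rewrite coef_take_poly coef0; case: ifP => // /p0.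
Qed.

Lemma comp_poly_subr p q1 q2 : exists r, (p \Po q1) - (p \Po q2) = (q1 - q2) * r.
Proof.
exists (\sum_(i < size p) p`_i *: \sum_(j < i) q1 ^+ (i.-1 - j) * q2 ^+ j).
rewrite !comp_polyE mulr_sumr -sumrB; apply: eq_bigr => i _.
by rewrite -scalerBr subrXX scalerAr.
Qed.

(** Composition is well defined modulo z^n: (p1 - p2) o q1 is divisible by q1^n, hence by z^n as
    [q1] has no constant term, and p2 o q1 - p2 o q2 is divisible by q1 - q2. *)
Lemma comp_poly_cong n p1 p2 q1 q2 : q1`_0 = 0 ->
  (forall i, (i < n)%N -> p1`_i = p2`_i) ->
  (forall i, (i < n)%N -> q1`_i = q2`_i) ->
  forall i, (i < n)%N -> (p1 \Po q1)`_i = (p2 \Po q2)`_i.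
Proof.
move=> q0 Ep Eq i lt_in; apply/eqP; rewrite -subr_eq0 -coefB; apply/eqP.
have /poly_lowE dp : forall i, (i < n)%N -> (p1 - p2)`_i = 0.
  by move=> j /Ep; rewrite coefB => ->; rewrite subrr.
have /poly_lowE dq : forall i, (i < n)%N -> (q1 - q2)`_i = 0.
  by move=> j /Eq; rewrite coefB => ->; rewrite subrr.
have /poly_lowE Dq : forall i, (i < 1)%N -> q1`_i = 0 by case.
have [r Dr] := comp_poly_subr p2 q1 q2.
have -> : (p1 \Po q1) - (p2 \Po q2)
  = ((p1 - p2) \Po q1) + ((p2 \Po q1) - (p2 \Po q2)).
  by rewrite raddfB /= addrA subrK.
rewrite {}Dr dq dp comp_polyM comp_Xn_poly {2}Dq expr1 exprMn mulrA.
rewrite [_ * 'X^n * r]mulrAC -mulrDl coefMXn lt_in //.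
Qed.

Lemma coef_fps_trunc n A i : (fps_trunc n A)`_i = if (i <= n)%N then A i else 0.
Proof. by rewrite coef_poly ltnS. Qed.

(** Frees [fps_comp] from the truncation level chosen in its definition, so that identities between
    polynomials transfer to series. *)
Lemma fps_comp_coef N A B p q : B 0%N = 0 ->
  (forall i, (i <= N)%N -> p`_i = A i) ->
  (forall i, (i <= N)%N -> q`_i = B i) ->
  forall i, (i <= N)%N -> fps_comp A B i = (p \Po q)`_i.
Proof.
move=> B0 Ep Eq i le_iN.
apply: (@comp_poly_cong i.+1); rewrite ?coef_fps_trunc // => j lt_ji;
by rewrite coef_fps_trunc -ltnS lt_ji ?Ep ?Eq //; apply: leq_trans le_iN.
Qed.

Lemma fps_comp_trunc N A B i : B 0%N = 0 -> (i <= N)%N ->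
  fps_comp A B i = (fps_trunc N A \Po fps_trunc N B)`_i.
Proof.
by move=> B0; apply: fps_comp_coef => // j lejN; rewrite coef_fps_trunc lejN.
Qed.

Lemma fps_comp0 A B : B 0%N = 0 -> fps_comp A B 0%N = A 0%N.
Proof.
move=> B0; rewrite (@fps_comp_trunc 0) // -horner_coef0 horner_comp.
by rewrite horner_coef0 coef_fps_trunc /= B0 horner_coef0 coef_fps_trunc.
Qed.

Lemma fps_compA A B C : B 0%N = 0 -> C 0%N = 0 ->
  fps_comp (fps_comp A B) C = fps_comp A (fps_comp B C).
Proof.
move=> B0 C0; apply/funext => n.
pose a := fps_trunc n A; pose b := fps_trunc n B; pose c := fps_trunc n C.
rewrite (@fps_comp_coef n _ _ (a \Po b) c) //; last 2 first.
- by move=> i le_in; rewrite -fps_comp_trunc.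
- by move=> i le_in; rewrite coef_fps_trunc le_in.
rewrite (@fps_comp_coef n _ _ a (b \Po c)) ?comp_polyA ?fps_comp0 //.
- by move=> i le_in; rewrite coef_fps_trunc le_in.
- by move=> i le_in; rewrite -fps_comp_trunc.
Qed.

Lemma fps_comp_XnE A n i : (0 < n)%N ->
  fps_comp A (@fps_Xn K n) i = if (n %| i)%N then A (i %/ n)%N else 0.
Proof.
move=> n0; rewrite (@fps_comp_coef i _ _ (fps_trunc i A) 'X^n) //.
- rewrite coef_comp_poly_Xn // coef_fps_trunc.
  by rewrite leq_div.
- by rewrite /fps_Xn; case: n n0.
- by move=> j le_ji; rewrite coef_fps_trunc le_ji.
- by move=> j le_ji; rewrite coefXn.
Qed.

Lemma fps_Xn0 n : (0 < n)%N -> @fps_Xn K n 0%N = 0.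
Proof. by case: n. Qed.

Lemma fps_comp_X A : fps_comp A (fps_Xn K 1) = A.
Proof. by apply/funext => i; rewrite fps_comp_XnE // dvd1n divn1. Qed.

Lemma fps_comp_Xl A : A 0%N = 0 -> fps_comp (fps_Xn K 1) A = A.
Proof.
move=> A0; apply/funext => i.
rewrite (@fps_comp_coef i _ _ 'X (fps_trunc i A)) //.
- by rewrite comp_polyX coef_fps_trunc leqnn.
- by move=> j _; rewrite coefX.
- by move=> j le_ji; rewrite coef_fps_trunc le_ji.
Qed.

Lemma fps_comp_XnXn m n : (0 < n)%N ->
  fps_comp (fps_Xn K m) (fps_Xn K n) = fps_Xn K (m * n).
Proof.
move=> n0; apply/funext => i; rewrite fps_comp_XnE // /fps_Xn.
case: dvdnP => [[j ->]|ndvd]; first by rewrite mulnK // eqn_pmul2r.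
by case: eqP => // Di; case: ndvd; exists m.
Qed.

Lemma coef0_mul p q : (p * q)`_0 = p`_0 * q`_0.
Proof. by rewrite -!horner_coef0 hornerM. Qed.

(** First-order perturbation. Write p = g z^m. Then q1^m - q2^m is q1 - q2 times m terms of degree m
    - 1 in [q1] and [q2], which share their coefficient at z^M because M < k. The change in g only
    matters from z^(k + m M) on. *)
Lemma comp_poly_diff m M k p q1 q2 : (0 < m)%N -> (0 < M < k)%N ->
  (forall i, (i < m)%N -> p`_i = 0) ->
  (forall i, (i < M)%N -> q1`_i = 0) ->
  (forall i, (i < k)%N -> q1`_i = q2`_i) ->
  forall i, (i <= k + m.-1 * M)%N -> (p \Po q1)`_i - (p \Po q2)`_i =
    if i == (k + m.-1 * M)%N
    then p`_m * q1`_M ^+ m.-1 * m%:R * (q1`_k - q2`_k) else 0.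
Proof.
move=> m0 /andP[M0 ltMk] p0 q10 Eq i le_i.
have q20 j : (j < M)%N -> q2`_j = 0.
  by move=> ltjM; rewrite -Eq ?q10 //; apply: ltn_trans ltMk.
have /poly_lowE : forall j, (j < k)%N -> (q1 - q2)`_j = 0.
  by move=> j /Eq; rewrite coefB => ->; rewrite subrr.
set d := drop_poly _ _ => Dd.
have d0 : d`_0 = q1`_k - q2`_k by rewrite coef_drop_poly add0n coefB.
have q10_0 := q10 _ M0.
move/poly_lowE: q10; set a1 := drop_poly _ _ => Da1.
move/poly_lowE: q20; set a2 := drop_poly _ _ => Da2.
move/poly_lowE: p0; set g := drop_poly _ _ => Dg.
have a10 : a1`_0 = q1`_M by rewrite coef_drop_poly.
have a20 : a2`_0 = q1`_M by rewrite coef_drop_poly Eq.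
have g0 : g`_0 = p`_m by rewrite coef_drop_poly.
have [h Dh] := comp_poly_subr g q1 q2.
pose S := \sum_(j < m) a1 ^+ (m.-1 - j) * a2 ^+ j.
have DS : S`_0 = q1`_M ^+ m.-1 * m%:R.
  rewrite -horner_coef0 horner_sum (eq_bigr (fun _ => q1`_M ^+ m.-1)).
    by rewrite sumr_const card_ord mulr_natr.
  move=> j _; rewrite hornerM !horner_exp !horner_coef0 a10 a20 -exprD subnK //.
  by rewrite -ltnS prednK.
(* The difference divided by z^(k + (m-1) M); since M > 0, the second summand does not affect the
   constant term. *)
pose e := d * S * (g \Po q1) + a2 ^+ m * d * h * 'X^M.
have Dpe : (p \Po q1) - (p \Po q2) = e * 'X^(k + m.-1 * M).
  have -> : (p \Po q1) - (p \Po q2) =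
     (q1 ^+ m - q2 ^+ m) * (g \Po q1) + q2 ^+ m * ((g \Po q1) - (g \Po q2)).
    by rewrite Dg !comp_polyM !comp_Xn_poly; ring.
  have -> : q1 ^+ m - q2 ^+ m = d * S * 'X^(k + m.-1 * M).
    rewrite subrXX Dd /S exprD -!mulrA; congr (_ * _).
    rewrite [RHS]mulrCA; congr (_ * _); rewrite mulr_suml; apply: eq_bigr => j _.
    have lej : (j <= m.-1)%N by rewrite -ltnS prednK.
    rewrite Da1 Da2 !exprMn mulrACA -exprM -exprM -exprD -mulnDr subnK //.
    by rewrite mulnC.
  rewrite Dh Dd Da2 exprMn -exprM /e.
  have -> : (M * m = M + m.-1 * M)%N by rewrite -mulSn prednK // mulnC.
  rewrite !exprD; ring.
rewrite -coefB Dpe coefMXn; case: (ltngtP i) le_i => // -> _.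
rewrite subnn coefD coefMXn M0 addr0 !coef0_mul d0 DS.
rewrite -[(g \Po q1)`_0]horner_coef0 horner_comp !horner_coef0 q10_0 horner_coef0 g0.
ring.
Qed.

(** * Orders and leading coefficients under composition *)

(** A relational form of [ord] that excludes the zero series, and with it the default value 0. *)
Definition has_order m A := A m != 0 /\ forall i, (i < m)%N -> A i = 0.

Lemma has_order_ord m A : has_order m A -> ord A = m.
Proof.
move=> [Am A0]; rewrite /ord; case: pselect => [nzA|[]]; last by exists m.
case: ex_minnP => j Aj minj; apply/eqP; rewrite eqn_leq minj //= leqNgt.
by apply/negP => /A0 Aj0; rewrite Aj0 eqxx in Aj.
Qed.

Lemma ord_has_order A : (exists n, A n != 0) -> has_order (ord A) A.
Proof.
move=> exA; rewrite /ord; case: pselect => // nzA.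
case: ex_minnP => j Aj minj; split=> // i; rewrite ltnNge.
by apply: contraNeq => /minj.
Qed.

Lemma k1P A : k1 A <-> has_order 1 A.
Proof.
split=> [[exA <-]|oA]; first exact: ord_has_order.
by split; [exists 1%N; case: oA | apply: has_order_ord].
Qed.

Lemma GammaP A : Gamma A <-> exists2 m, (2 <= m)%N & has_order m A.
Proof.
split=> [[exA le2]|[m m2 oA]]; first by exists (ord A); last exact: ord_has_order.
by split; [exists m; case: oA | rewrite (has_order_ord oA)].
Qed.

Lemma has_order_Xn m : has_order m (fps_Xn K m).
Proof.
by split=> [|i lt_im]; rewrite /fps_Xn ?eqxx ?oner_eq0 // ltn_eqF.
Qed.

(** With C = z^m g and X = z^M x, the composition is z^(m M) x^m (g o X). *)
Lemma fps_comp_lead m M C X : (0 < M)%N -> has_order m C -> has_order M X ->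
  (forall i, (i < m * M)%N -> fps_comp C X i = 0) /\
  fps_comp C X (m * M)%N = C m * X M ^+ m.
Proof.
move=> M0 [_ C0] [_ X0].
pose c := fps_trunc (m * M) C; pose x := fps_trunc (m * M) X.
have /poly_lowE Dc : forall i, (i < m)%N -> c`_i = 0.
  by move=> i lt_im; rewrite coef_fps_trunc C0 // if_same.
have x0 : forall i, (i < M)%N -> x`_i = 0.
  by move=> i lt_iM; rewrite coef_fps_trunc X0 // if_same.
have /poly_lowE Dx := x0.
have Dcx : c \Po x = (drop_poly M x) ^+ m * (drop_poly m c \Po x) * 'X^(m * M).
  by rewrite {1}Dc comp_polyM comp_Xn_poly {2}Dx exprMn -exprM mulnC; ring.
have E i : (i <= m * M)%N -> fps_comp C X i = (c \Po x)`_i.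
  by move=> le_i; apply: fps_comp_trunc; rewrite ?X0.
split=> [i lt_i|]; first by rewrite E ?(ltnW lt_i) // Dcx coefMXn lt_i.
rewrite E // Dcx coefMXn ltnn subnn coef0_mul -!horner_coef0 horner_comp.
rewrite horner_exp !horner_coef0 x0 // horner_coef0 !coef_drop_poly !add0n.
(* For m = 0 the truncation at m M = 0 loses [X M], but its exponent is 0; for m > 0 it keeps the
   indices m and M. *)
case: m @c @x Dc {x0} Dx Dcx E C0 => [|m] c x _ _ _ _ _.
  by rewrite !expr0 mulr1 mul1r coef_fps_trunc.
rewrite !coef_fps_trunc leq_pmulr // leq_pmull //.
by rewrite mulrC.
Qed.

Lemma has_order_comp m M C X : (0 < M)%N -> has_order m C -> has_order M X ->
  has_order (m * M) (fps_comp C X).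
Proof.
move=> M0 oC oX; have [low lead] := fps_comp_lead M0 oC oX; split=> //.
by rewrite lead mulf_neq0 ?expf_neq0 //; [case: oC | case: oX].
Qed.

Lemma fps_comp_diff m M k C X Y : (0 < m)%N -> (0 < M < k)%N ->
  (forall i, (i < m)%N -> C i = 0) ->
  (forall i, (i < M)%N -> X i = 0) ->
  (forall i, (i < k)%N -> X i = Y i) ->
  forall i, (i <= k + m.-1 * M)%N -> fps_comp C X i - fps_comp C Y i =
    if i == (k + m.-1 * M)%N
    then C m * X M ^+ m.-1 * m%:R * (X k - Y k) else 0.
Proof.
move=> m0 /andP[M0 ltMk] C0 X0 EXY i le_i; set N := (k + m.-1 * M)%N.
have leMN : (M <= N)%N by rewrite (leq_trans (ltnW ltMk)) ?leq_addr.
have lekN : (k <= N)%N by rewrite leq_addr.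
have lemN : (m <= N)%N.
  by rewrite /N -[X in (X <= _)%N](prednK m0); nia.
have X00 := X0 _ M0; have Y00 : Y 0%N = 0 by rewrite -EXY ?(ltn_trans M0).
rewrite !(@fps_comp_trunc N) //.
rewrite (@comp_poly_diff m M k) ?M0 //; rewrite ?coef_fps_trunc ?lemN ?leMN ?lekN //.
- by move=> j ltj; rewrite coef_fps_trunc C0 // if_same.
- by move=> j ltj; rewrite coef_fps_trunc X0 // if_same.
- by move=> j ltj; rewrite !coef_fps_trunc EXY.
Qed.

(** If X and Y agree below k > M, the two compositions differ at index k + (m-1) M by a nonzero
    multiple of X_k - Y_k. Fixing the leading coefficient removes the ambiguity by roots of
    unity. *)
Lemma fps_comp_inj m M C X Y : (0 < m)%N -> m%:R != 0 :> K -> (0 < M)%N ->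
  has_order m C -> has_order M X -> has_order M Y -> X M = Y M ->
  fps_comp C X = fps_comp C Y -> X = Y.
Proof.
move=> m0 charm M0 [Cm C0] [XM X0] [_ Y0] EM ECXY; apply/funext => k.
elim/ltn_ind: k => k IHk.
have [ltkM|ltMk|->//] := ltngtP k M; first by rewrite X0 ?Y0.
have := @fps_comp_diff m M k C X Y m0 _ C0 X0 IHk _ (leqnn _).
rewrite M0 ltMk eqxx ECXY subrr => /(_ isT)/esym/eqP.
by rewrite !mulf_eq0 expf_eq0 (negPf Cm) (negPf XM) (negPf charm) andbF subr_eq0 => /eqP.
Qed.

End SeriesComposition.

(** * Sequences constructed term by term *)

Section SequenceRecursion.
Variables (T : choiceType) (t0 : T) (R : nat -> (nat -> T) -> Prop).

(** Each [R n] sees only the terms up to n, and [R n] can be achieved without touching the terms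
    below n. *)
Lemma seq_rec_exists :
  (forall n X Y, (forall i, (i <= n)%N -> X i = Y i) -> R n X -> R n Y) ->
  (forall n X, (forall i, (i < n)%N -> R i X) ->
     exists2 Y, forall i, (i < n)%N -> X i = Y i & R n Y) ->
  exists X, forall n, R n X.
Proof.
move=> Rlocal Rext.
pose good n X Y := (forall i, (i < n)%N -> X i = Y i) /\ R n Y.
pose step n X := xget X (good n X).
have stepP n X : (forall i, (i < n)%N -> R i X) -> good n X (step n X).
  by move=> /Rext[Y EXY RY]; apply: (@xgetPex _ X (good n X)); exists Y.
pose U := fix U n := if n is n'.+1 then step n' (U n') else fun=> t0.
have UR n : forall i, (i < n)%N -> R i (U n).
  elim: n => // n IHn i; have [EU RU] := stepP n (U n) IHn.
  rewrite ltnS leq_eqVlt => /predU1P[-> //|lt_in].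
  apply: Rlocal (IHn i lt_in) => j le_ji.
  by apply: EU; apply: leq_ltn_trans lt_in.
have UE n : forall i, (i < n)%N -> U n i = U i.+1 i.
  elim: n => // n IHn i; rewrite ltnS leq_eqVlt => /predU1P[-> //|lt_in].
  by rewrite -IHn //; have [EU _] := stepP n (U n) (UR n); rewrite [RHS]EU.
(* Later stages preserve earlier terms, so the diagonal agrees with [U n.+1] up to index n. *)
exists (fun i => U i.+1 i) => n; apply: Rlocal (UR n.+1 n (ltnSn n)) => i le_in.
exact: UE.
Qed.

End SequenceRecursion.

(** * Solving equations between series coefficient by coefficient *)

Section SeriesEquations.
Import GRing.Theory.
Local Open Scope ring_scope.
Variable K : fieldType.
Hypothesis natK : forall n, (0 < n)%N -> n%:R != 0 :> K.
Implicit Types (A B C X Y mu nu : fps K) (m n M k : nat).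

Lemma fps_comp_local m k C X Y : (0 < m)%N -> (1 < k)%N ->
  (forall i, (i < m)%N -> C i = 0) -> X 0%N = 0 ->
  (forall i, (i < k)%N -> X i = Y i) ->
  forall i, (i < k + m.-1)%N -> fps_comp C X i = fps_comp C Y i.
Proof.
move=> m0 k1 C0 X0 EXY i lt_i; apply/eqP; rewrite -subr_eq0.
rewrite (@fps_comp_diff K m 1 k) ?muln1 ?ltn_eqF ?(ltnW lt_i) //.
by case.
Qed.

(* The coefficient of z^(m-1+k) in C(X) is m C_m c^(m-1) X_k plus a function of
   the X_i with i < k, so the coefficients of X are determined one by one. *)
Lemma fps_comp_solve m c C (D : fps K -> fps K) :
  (0 < m)%N -> has_order m C -> c != 0 ->
  (forall k X Y, (1 < k)%N -> (forall i, (i < k)%N -> X i = Y i) ->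
     forall i, (i <= k + m.-1)%N -> D X i = D Y i) ->
  (forall X, X 0%N = 0 -> X 1%N = c ->
     (forall i, (i < m)%N -> D X i = 0) /\ D X m = C m * c ^+ m) ->
  exists X, [/\ X 0%N = 0, X 1%N = c & fps_comp C X = D X].
Proof.
move=> m0 oC c0 Dlocal Dinit; have [Cm C0] := oC.
(* For n >= 2, the unknown X_n is governed by the equation at index n + m - 1; the equations at
   indices up to m are left to [Dinit]. *)
pose R n X := match n with
  | 0 => X 0%N = 0
  | 1 => X 1%N = c
  | _ => X 0%N = 0 -> X 1%N = c -> fps_comp C X (n + m.-1)%N = D X (n + m.-1)%N
  end.
have [||X RX] := @seq_rec_exists K 0 R.
- case=> [|[|n]] X Y EXY /=; rewrite -!EXY // => RX X0 X1.
  rewrite -(@fps_comp_local m n.+3 C X Y) // RX //.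
  by apply: (Dlocal n.+3).
- case=> [|[|n]] X RX; first by exists (fun=> 0).
    by exists (fun i => if i == 0%N then 0 else c) => //; case=> // _; exact: (RX 0%N).
  have /= X0 := RX 0%N isT; have /= X1 := RX 1%N isT.
  pose N := (n.+2 + m.-1)%N.
  pose a := C m * c ^+ m.-1 * m%:R.
  have a0 : a != 0 by rewrite !mulf_neq0 ?expf_neq0 ?natK.
  (* Raising the coefficient of index n + 2 by t raises coefficient N of C o X by a t and leaves
     that of [D X] unchanged. *)
  pose Y i := if i == n.+2 then X i + (D X N - fps_comp C X N) / a else X i.
  have EXY i : (i < n.+2)%N -> X i = Y i by rewrite /Y => /ltn_eqF->.
  exists Y => //= _ _; rewrite -/N.
  have := @fps_comp_diff K m 1 n.+2 C X Y m0 isT C0 _ EXY N.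
  rewrite muln1 leqnn eqxx X1 -/a => /(_ _ isT) E.
  have {}E : fps_comp C X N - fps_comp C Y N = fps_comp C X N - D X N.
    rewrite E; last by case.
    by rewrite /Y eqxx opprD addNKr mulrN mulrC divfK // opprB.
  have -> : D Y N = D X N by apply: (Dlocal n.+2) => // i ?; rewrite EXY.
  by apply: oppr_inj; apply: (addrI (fps_comp C X N)).
exists X; have /= X0 := RX 0%N; have /= X1 := RX 1%N; split=> //.
have oX : has_order 1 X by split; [rewrite X1 | case].
have := @fps_comp_lead K m 1 C X isT oC oX; rewrite !muln1 => -[low lead].
have [Dlow Dlead] := Dinit X X0 X1.
apply/funext => i; have [lt_im|lt_mi|->] := ltngtP i m.
- by rewrite low ?Dlow.
- have /= := RX (i - m.-1)%N.
  have -> : (i - m.-1 = (i - m.+1).+2)%N by lia.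
  by rewrite /R => /(_ X0 X1); have -> : ((i - m.+1).+2 + m.-1 = i)%N by lia.
- by rewrite lead X1 Dlead.
Qed.

(** The case of a constant operator [D]; the condition on [c] compares the coefficients of z^m. *)
Lemma fps_comp_root m c C mu : (0 < m)%N -> has_order m C -> has_order 1 mu ->
  C m * c ^+ m = mu 1%N ->
  exists nu, [/\ has_order 1 nu, nu 1%N = c & fps_comp C nu = fps_comp mu (fps_Xn K m)].
Proof.
move=> m0 oC omu Ec; have [mu1 _] := omu.
have c0 : c != 0.
  by apply: contraNneq mu1 => c0; rewrite -Ec c0 expr0n gtn_eqF ?mulr0.
have [low lead] := fps_comp_lead m0 omu (has_order_Xn K m).
rewrite mul1n in low lead.
have [||nu [nu0 nu1 E]] := @fps_comp_solve m c C (fun=> fps_comp mu (fps_Xn K m)) m0 oC c0.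
- by [].
- by move=> X _ _; split=> //; rewrite lead /fps_Xn eqxx mulr1 Ec.
by exists nu; split=> //; split; [rewrite nu1 | case].
Qed.

(** * Inverses of series of order 1 *)

(** The case m = 1 of [fps_comp_root] gives right inverses. If nu is one of mu and rho one of nu,
    then mu = mu o nu o rho = rho, so nu is two-sided. *)
Lemma fps_inv_exists mu : has_order 1 mu -> exists nu, is_fps_inv mu nu.
Proof.
have rinv a : has_order 1 a ->
    exists2 b, has_order 1 b & fps_comp a b = fps_Xn K 1.
  move=> oa; have [a1 _] := oa.
  have E : a 1%N * (a 1%N)^-1 ^+ 1 = fps_Xn K 1 1%N.
    by rewrite expr1 divff.
  have [b [ob _ Eb]] := @fps_comp_root 1 _ _ _ isT oa (has_order_Xn K 1) E.
  by exists b => //; rewrite Eb fps_comp_X.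
move=> omu; have [nu onu Enu] := rinv _ omu; have [rho orho Erho] := rinv _ onu.
have Dmu : mu = rho.
  have [[[_ mu0] [_ nu0]] [_ rho0]] := (omu, onu, orho).
  by rewrite -[LHS]fps_comp_X -Erho -fps_compA ?nu0 ?rho0 // Enu fps_comp_Xl ?rho0.
by exists nu; split=> //; [apply/k1P | rewrite Dmu].
Qed.

Lemma fps_invP mu : has_order 1 mu -> is_fps_inv mu (fps_inv mu).
Proof.
move=> omu; rewrite /fps_inv; case: pselect => [inv_mu|[]].
  by case: (cid inv_mu).
exact: fps_inv_exists.
Qed.

Lemma has_order_inv mu : has_order 1 mu -> has_order 1 (fps_inv mu).
Proof. by case/fps_invP => /k1P. Qed.

Lemma fps_mulVK mu X : has_order 1 mu -> X 0%N = 0 ->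
  fps_comp mu (fps_comp (fps_inv mu) X) = X.
Proof.
move=> omu X0; have [/k1P[_ inv0] E _] := fps_invP omu.
by rewrite -fps_compA ?inv0 // E fps_comp_Xl.
Qed.

Lemma fps_mulKV mu X : has_order 1 mu -> X 0%N = 0 ->
  fps_comp (fps_inv mu) (fps_comp mu X) = X.
Proof.
move=> omu X0; have [_ _ E] := fps_invP omu.
by have [_ mu0] := omu; rewrite -fps_compA ?mu0 // E fps_comp_Xl.
Qed.

Lemma fps_compK mu X : has_order 1 mu ->
  fps_comp (fps_comp X mu) (fps_inv mu) = X.
Proof.
move=> omu; have [/k1P[_ inv0] E _] := fps_invP omu; have [_ mu0] := omu.
by rewrite fps_compA ?inv0 ?mu0 // E fps_comp_X.
Qed.

Lemma fps_compVK mu X : has_order 1 mu ->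
  fps_comp (fps_comp X (fps_inv mu)) mu = X.
Proof.
move=> omu; have [/k1P[_ inv0] _ E] := fps_invP omu; have [_ mu0] := omu.
by rewrite fps_compA ?inv0 ?mu0 // E fps_comp_X.
Qed.

Lemma fps_inv_X : fps_inv (fps_Xn K 1) = fps_Xn K 1.
Proof.
have [/k1P[_ inv0] E _] := fps_invP (has_order_Xn K 1).
by rewrite fps_comp_Xl ?inv0 in E.
Qed.

(** * Linearization of decompositions *)

Local Notation orders s := [seq ord A | A <- s].
Local Notation Xn := (fps_Xn K).

Definition positive_order A := exists2 m, (0 < m)%N & has_order m A.

Lemma positive_ord A : positive_order A -> (0 < ord A)%N /\ has_order (ord A) A.
Proof. by case=> m m0 oA; rewrite (has_order_ord oA). Qed.

Lemma positive_order0 A : positive_order A -> A 0%N = 0.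
Proof. by case=> m m0 [_]; apply. Qed.

Lemma has_order_comp_seq (s : seq (fps K)) :
  (forall i, (i < size s)%N -> positive_order (nth (Xn 1) s i)) ->
  (0 < \prod_(m <- orders s) m)%N /\
  has_order (\prod_(m <- orders s) m)%N (fps_comp_seq s).
Proof.
elim: s => [|A s IHs] posA /=; first by rewrite big_nil; split=> //; apply: has_order_Xn.
have [IH0 IHo] := IHs (fun i => posA i.+1).
have [m0 oA] := positive_ord (posA 0%N isT).
by rewrite big_cons muln_gt0 m0; split=> //; apply: has_order_comp.
Qed.

(** A ladder of coordinate changes: r factors need the r + 1 series [lam 0], ..., [lam r]. *)
Definition linearizing (s : seq (fps K)) (ns : seq nat) (lam : nat -> fps K) :=
  (forall i, (i <= size s)%N -> has_order 1 (lam i)) /\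
  (forall i, (i < size s)%N ->
     fps_comp (nth (Xn 1) s i) (lam i.+1) = fps_comp (lam i) (Xn (nth 0%N ns i))).

(** The relations telescope from the right. This computes the composite of a decomposition built
    from a given ladder. *)
Lemma linearizing_comp s ns lam : size ns = size s -> all (leq 1) ns ->
  linearizing s ns lam ->
  (forall i, (i < size s)%N -> positive_order (nth (Xn 1) s i)) ->
  fps_comp (fps_comp_seq s) (lam (size s)) =
    fps_comp (lam 0%N) (Xn (\prod_(m <- ns) m)%N).
Proof.
elim: s ns lam => [|A s IHs] [|m ns] lam //=.
  move=> _ _ [/(_ 0%N isT) [_ lam0] _] _.
  by rewrite big_nil fps_comp_X fps_comp_Xl ?lam0.
move=> [Esz] /andP[m0 ns0] [olam Elam] posA.
have pos_s i : (i < size s)%N -> positive_order (nth (Xn 1) s i) := posA i.+1.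
have [M0 [_ oS]] := has_order_comp_seq pos_s.
have [_ lamS] := olam (size s).+1 (leqnn _).
rewrite fps_compA ?lamS ?oS // (IHs ns (fun i => lam i.+1)) //; last first.
  by split=> i le_i; [apply: olam | apply: (Elam i.+1)].
have [_ lam1] := olam 1%N isT.
have N0 : (0 < \prod_(j <- ns) j)%N.
  elim: ns ns0 {IHs Esz Elam} => [|j ns IH] /=; rewrite ?big_nil // big_cons muln_gt0.
  by case/andP=> -> /IH.
rewrite -fps_compA ?lam1 ?fps_Xn0 // (Elam 0%N isT) /=.
by rewrite fps_compA ?fps_Xn0 // fps_comp_XnXn // big_cons.
Qed.

(* If s = A_1 :: s', let c be the leading coefficient of X = s' o nu.  A solution
   mu_1 of A_1 o mu_1 = mu o z^m with linear coefficient c satisfies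
   A_1 o X = A_1 o (mu_1 o z^M) with equal leading coefficients, so
   X = mu_1 o z^M and the induction hypothesis applies to s', mu_1 and nu. *)
Lemma linearizing_exists s mu nu :
  (forall i, (i < size s)%N -> positive_order (nth (Xn 1) s i)) ->
  has_order 1 mu -> has_order 1 nu ->
  fps_comp (fps_comp_seq s) nu = fps_comp mu (Xn (\prod_(m <- orders s) m)%N) ->
  exists lam, [/\ lam 0%N = mu, lam (size s) = nu & linearizing s (orders s) lam].
Proof.
elim: s mu => [|A s IHs] mu posA omu onu /=.
  rewrite big_nil fps_comp_X fps_comp_Xl; last by case: onu => _; apply.
  by move=> ->; exists (fun=> mu).
have pos_s i : (i < size s)%N -> positive_order (nth (Xn 1) s i) := posA i.+1.
have [m0 oA] := positive_ord (posA 0%N isT).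
rewrite big_cons; set m := ord A in m0 oA *; set M := (\prod_(j <- _) j)%N.
have [M0 oS] := has_order_comp_seq pos_s; rewrite -/M in M0 oS.
have [_ nu0] := onu; have [_ S0] := oS.
set X := fps_comp (fps_comp_seq s) nu.
have oX : has_order M X by rewrite -[M]muln1; apply: has_order_comp.
rewrite fps_compA ?nu0 ?S0 // -/X => EA.
have mM0 : (0 < m * M)%N by rewrite muln_gt0 m0.
have lead : A m * X M ^+ m = mu 1%N.
  have [_ <-] := fps_comp_lead M0 oA oX.
  have [_] := fps_comp_lead mM0 omu (has_order_Xn K (m * M)).
  by rewrite mul1n EA => ->; rewrite /fps_Xn eqxx expr1n mulr1.
have [mu1 [omu1 Elead Emu1]] := fps_comp_root m0 oA omu lead.
have [_ mu10] := omu1.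
have oY : has_order M (fps_comp mu1 (Xn M)).
  by rewrite -[M]mul1n; apply: has_order_comp => //; rewrite mul1n; apply: has_order_Xn.
have EX : X = fps_comp mu1 (Xn M).
  apply: (fps_comp_inj m0 (natK m0) M0 oA oX oY).
    have [_] := fps_comp_lead M0 omu1 (has_order_Xn K M).
    by rewrite mul1n => ->; rewrite Elead /fps_Xn eqxx expr1n mulr1.
  rewrite EA -fps_compA ?mu10 ?fps_Xn0 // Emu1.
  by rewrite fps_compA ?fps_Xn0 // fps_comp_XnXn.
have [lam [lam0 lamS [olam Elam]]] := IHs mu1 pos_s omu1 onu EX.
exists (fun i => if i is j.+1 then lam j else mu); split=> //.
by split=> [[|i] //|[|i]] => [/olam|_|/Elam] //=; rewrite lam0.
Qed.


(** * Equivalence of decompositions and equality of orders *)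

Lemma equiv_of_intertwining s t lam :
  (1 < size s)%N -> size s = size t ->
  (forall i, (i <= size s)%N -> has_order 1 (lam i)) ->
  lam 0%N = Xn 1 -> lam (size s) = Xn 1 ->
  (forall i, (i < size s)%N -> nth (Xn 1) t i 0%N = 0) ->
  (forall i, (i < size s)%N ->
     fps_comp (nth (Xn 1) s i) (lam i.+1) = fps_comp (lam i) (nth (Xn 1) t i)) ->
  equiv_decomposition s t.
Proof.
move=> s2 Est olam lam0 lamS t0 Elam; split=> //.
have Esz : (size s).-2.+2 = size s by lia.
have ES i : (i < size s)%N -> nth (Xn 1) s i =
    fps_comp (fps_comp (lam i) (nth (Xn 1) t i)) (fps_inv (lam i.+1)).
  by move=> lti; rewrite -Elam // fps_compK //; apply: olam.
(* Conjugators are numbered from 0, the one between factors i and i + 1 being [lam i.+1]; the outer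
   two, [lam 0] and [lam (size s)], are z and disappear from the end factors. *)
exists (fun i => lam i.+1); split.
- by move=> i lti; apply/k1P/olam; lia.
- by rewrite ES ?lam0 ?fps_comp_Xl ?t0 //; lia.
- by move=> [//|i] /andP[_ lti]; rewrite ES //; lia.
- rewrite ES; last by lia.
  rewrite (_ : (size s).-1.+1 = size s) ?lamS; last by lia.
  rewrite fps_inv_X fps_comp_X; congr fps_comp.
  by congr lam; lia.
Qed.

Lemma Gamma_positive_order A : Gamma A -> positive_order A.
Proof. by case/GammaP=> m m2 oA; exists m => //; apply: ltnW. Qed.

Lemma decomposition_positive A s : decomposition A s ->
  forall i, (i < size s)%N -> positive_order (nth (Xn 1) s i).
Proof. by case=> _ sGamma _ i /sGamma/Gamma_positive_order. Qed.

Lemma decomposition_ord A s : decomposition A s ->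
  (\prod_(m <- orders s) m)%N = ord A.
Proof.
move=> sA; have [_ oS] := has_order_comp_seq (decomposition_positive sA).
by case: sA => _ _ <-; rewrite (has_order_ord oS).
Qed.

Lemma decomposition_linearizing A s beta : decomposition A s -> has_order 1 beta ->
  fps_comp A beta = fps_comp beta (Xn (ord A)) ->
  exists lam, [/\ lam 0%N = beta, lam (size s) = beta & linearizing s (orders s) lam].
Proof.
move=> sA obeta Ebeta; apply: linearizing_exists => //.
  exact: decomposition_positive sA.
by rewrite (decomposition_ord sA); case: sA => _ _ ->.
Qed.

Lemma equiv_of_orders A s t beta : has_order 1 beta ->
  fps_comp A beta = fps_comp beta (Xn (ord A)) ->
  decomposition A s -> decomposition A t -> orders s = orders t ->
  equiv_decomposition s t.
Proof.
move=> obeta Ebeta sA tA Eord.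
have [mu [mu0 muS [omu Emu]]] := decomposition_linearizing sA obeta Ebeta.
have [nu [nu0 nuS [onu Enu]]] := decomposition_linearizing tA obeta Ebeta.
have Est : size s = size t by rewrite -(size_map (@ord K) s) Eord size_map.
rewrite -Est in onu nuS Enu; rewrite -Eord in Enu.
have Ebb : fps_comp beta (fps_inv beta) = Xn 1 by case: (fps_invP obeta).
have tpos := decomposition_positive tA.
(* Both ladders begin and end with the same [beta], so this conjugator is z at both ends. *)
apply: (@equiv_of_intertwining _ _ (fun i => fps_comp (mu i) (fps_inv (nu i)))) => //.
- by case: sA.
- move=> i lei; rewrite -[1%N]muln1; apply: has_order_comp => //; first exact: omu.
  exact/has_order_inv/onu.
- by rewrite mu0 nu0.
- by rewrite muS nuS.
- by move=> i lti; apply/positive_order0/tpos; rewrite -Est.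
move=> i lti.
have onu1 := onu i.+1 lti; have onui := onu i (ltnW lti).
have [_ inv0] := has_order_inv onu1; have [_ invi0] := has_order_inv onui.
have [_ mu10] := omu i.+1 lti.
have Ti0 : nth (Xn 1) t i 0%N = 0 by apply/positive_order0/tpos; rewrite -Est.
have n0 : (0 < nth 0%N (orders s) i)%N.
  rewrite (nth_map (Xn 1)) //.
  by case: (positive_ord (decomposition_positive sA lti)).
(* Inserting nu_(i+1) o nu_(i+1)^-1 after the factor of [t] reduces both sides to mu_i o z^(n_i) o
   nu_(i+1)^-1. *)
rewrite -[nth (Xn 1) t i](fps_compK _ onu1).
rewrite Enu // -fps_compA ?mu10 ?inv0 // Emu //.
have [_ nui0] := onui.
rewrite (@fps_compA _ (nu i)) ?fps_Xn0 ?inv0 // [RHS]fps_compA ?invi0 //; last first.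
  by rewrite !fps_comp0 ?fps_Xn0 ?nui0 ?inv0.
rewrite fps_mulKV ?fps_comp0 ?fps_Xn0 ?inv0 //.
by rewrite fps_compA ?fps_Xn0 ?inv0.
Qed.

(** Composition with a series of order 1 on either side preserves the order; first, middle and last
    factors are treated separately. *)
Lemma orders_of_equiv s t : equiv_decomposition s t -> (1 < size s)%N ->
  (forall i, (i < size s)%N -> positive_order (nth (Xn 1) t i)) ->
  orders s = orders t.
Proof.
move=> [Est [mu [kmu E0 Ei Elast]]] s2 tpos.
have omu i : (i < (size s).-1)%N -> has_order 1 (mu i) by move/kmu/k1P.
apply: (@eq_from_nth _ 0%N); rewrite ?size_map // => i lti.
rewrite !(nth_map (Xn 1)) // -?Est //.
have [m0 oT] := positive_ord (tpos i lti).
set T := nth _ t i in m0 oT *; apply: has_order_ord.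
have [i0|i0] := posnP i.
  have -> : nth (Xn 1) s i = fps_comp T (fps_inv (mu 0%N)) by rewrite i0 E0 /T i0.
  rewrite -[ord T]muln1; apply: has_order_comp => //.
  by apply/has_order_inv/omu; lia.
have [lt_i|ge_i] := ltnP i (size s).-1.
  rewrite Ei ?i0 // -/T -[ord T]mul1n -[(1 * _)%N]muln1.
  apply: has_order_comp => //; last exact/has_order_inv/omu.
  by apply: has_order_comp => //; apply: omu; lia.
have -> : i = (size s).-1 by lia.
rewrite Elast (_ : (size s).-1 = i) -/T; last by lia.
by rewrite -[ord T]mul1n; apply: has_order_comp => //; apply: omu; lia.
Qed.

(** Realizes every ordered factorization, which gives surjectivity of the correspondence. *)
Lemma boettcher_decompositionP A beta ns : has_order 1 beta ->
  fps_comp A beta = fps_comp beta (Xn (ord A)) ->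
  ordered_factorizations (ord A) ns ->
  decomposition A (boettcher_decomposition beta ns) /\
  orders (boettcher_decomposition beta ns) = ns.
Proof.
move=> obeta Ebeta [ns2 ns_ge2 Ens].
set s := boettcher_decomposition beta ns.
have Es : size s = size ns by rewrite size_mkseq.
have le2 i : (i < size ns)%N -> (1 < nth 0%N ns i)%N.
  by move=> lti; apply: (allP ns_ge2); apply: mem_nth.
have os i : (i < size ns)%N -> has_order (nth 0%N ns i) (nth (Xn 1) s i).
  move=> lti; rewrite nth_mkseq //=; have := le2 i lti; set m := nth _ _ i => m2.
  case: ifP => _; last case: ifP => _; last exact: has_order_Xn.
    by rewrite -[m]mul1n; apply: has_order_comp; rewrite ?mul1n ?(ltnW m2) //;
      apply: has_order_Xn.
  rewrite -[m]muln1; apply: has_order_comp; rewrite ?muln1 //.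
    exact: has_order_Xn.
  exact: has_order_inv.
(* The ladder is trivial except at the ends, matching beta in the first factor and beta^-1 in the
   last. *)
pose lam i := if (i == 0%N) || (i == size ns) then beta else Xn 1.
have slin : linearizing s ns lam.
  split=> [i _|i]; first by rewrite /lam; case: ifP => _ //; apply: has_order_Xn.
  rewrite Es => lti; rewrite nth_mkseq //= /lam.
  rewrite (ltn_eqF lti) orbF orFb.
  have -> : (i.+1 == size ns) = (i == (size ns).-1) by lia.
  case: (i =P 0%N) => [i0|_].
    (* Since r >= 2, the first factor is not also the last. *)
    by rewrite ifF ?fps_comp_X //; lia.
  have Xnm0 := fps_Xn0 K (ltnW (le2 i lti)).
  by case: ifP => _; rewrite ?fps_compVK ?fps_comp_X ?(fps_comp_Xl Xnm0).
have ns1 : all (leq 1) ns by apply: sub_all ns_ge2 => m /ltnW.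
have spos i : (i < size s)%N -> positive_order (nth (Xn 1) s i).
  rewrite Es => lti; exists (nth 0%N ns i); [exact/ltnW/le2 | exact: os].
split; last first.
  apply: (@eq_from_nth _ 0%N); rewrite size_map ?Es // => i lti.
  by rewrite (nth_map (Xn 1)) ?Es // (has_order_ord (os i lti)).
split; rewrite ?Es //.
  by move=> i lti; apply/GammaP; exists (nth 0%N ns i); [apply: le2 | apply: os].
have := linearizing_comp (esym Es) ns1 slin spos.
rewrite Es Ens /lam eqxx orbT /= -Ebeta => E.
by rewrite -[LHS](fps_compK _ obeta) E fps_compK.
Qed.

End SeriesEquations.

(** * Existence of Boettcher functions over an algebraically closed field *)

Section Boettcher.
Import GRing.Theory.
Local Open Scope ring_scope.
Variable K : closedFieldType.
Hypothesis natK : forall n, (0 < n)%N -> n%:R != 0 :> K.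
Implicit Types (A beta : fps K).

(** Moves the inverse to the other side, giving the form of the equation that can be solved and
    peeled. *)
Lemma is_boettcherP A beta : Gamma A -> is_boettcher A beta <->
  has_order 1 beta /\ fps_comp A beta = fps_comp beta (fps_Xn K (ord A)).
Proof.
move=> /Gamma_positive_order/positive_ord[n0 [_ A0]]; have {}A0 := A0 _ n0.
split=> [[/k1P obeta E]|[obeta E]]; split=> //; [|exact/k1P|].
  have [_ beta0] := obeta; have [_ inv0] := has_order_inv natK obeta.
  rewrite -E fps_compA ?beta0 // fps_mulVK //.
  by rewrite fps_comp0 ?beta0.
have [_ beta0] := obeta.
by rewrite fps_compA ?beta0 // E fps_mulKV // fps_Xn0.
Qed.

Lemma closed_root_exists n (a : K) : (0 < n)%N -> exists x, x ^+ n = a.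
Proof.
move=> n0; have [x Ex] := @solve_monicpoly K n (fun i => if i == 0%N then a else 0) n0.
exists x; rewrite Ex (bigD1 (Ordinal n0)) //= expr0 mulr1 big1 ?addr0 // => i.
by rewrite -val_eqE /= => /negPf->; rewrite mul0r.
Qed.

Lemma boettcher_exists A : Gamma A -> exists beta, is_boettcher A beta.
Proof.
move=> GA; have [_ n2] := GA; have [n0 oA] := positive_ord (Gamma_positive_order GA).
set n := ord A in n2 n0 oA; have [An _] := oA.
have n1 : (0 < n.-1)%N by lia.
(* In A o X = X o z^n, the coefficients of z^n require A_n c^n = c, that is, c^(n-1) = 1 / A_n. *)
have [c Ec] := closed_root_exists (A n)^-1 n1.
have c0 : c != 0.
  apply: contra_eq_neq Ec => ->.
  by rewrite expr0n gtn_eqF // eq_sym invr_eq0.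
have Ac : A n * c ^+ n = c by rewrite -[in c ^+ n](prednK n0) exprSr Ec mulrA divff ?mul1r.
have [||beta [beta0 beta1 E]] :=
    @fps_comp_solve K natK n c A (fun X => fps_comp X (fps_Xn K n)) n0 oA c0.
(* Coefficient i of X o z^n involves only X_(i/n), and i <= k + n - 1 < k n because k, n >= 2. *)
- move=> k X Y k1 EXY i le_i; rewrite !fps_comp_XnE //; case: ifP => // _.
  apply: EXY; rewrite ltn_divLR //; nia.
- move=> X X0 X1; split=> [i lt_in|]; last by rewrite fps_comp_XnE // dvdnn divnn n0 X1.
  by rewrite fps_comp_XnE // divn_small // X0 if_same.
exists beta; apply/is_boettcherP => //; split=> //.
by split; [rewrite beta1 | case].
Qed.

End Boettcher.

Theorem theorem1p1 (K : closedFieldType) (charK : [pchar K]%R =i pred0)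
    (A : fps K) (n : nat) (GammaA : Gamma A) (ordA : ord A = n) :
  (forall beta : fps K, is_boettcher A beta ->
   forall s : seq (fps K), decomposition A s ->
     decomposition A (boettcher_decomposition beta (map (@ord K) s)) /\
     equiv_decomposition s (boettcher_decomposition beta (map (@ord K) s))) /\
  (exists phi : set (seq (fps K)) -> seq nat,
     set_bij (decomposition_classes A) (ordered_factorizations n) phi /\
     (forall s : seq (fps K), decomposition A s ->
        phi (decomposition_class A s) = map (@ord K) s)).
Proof.
have natK m : 0 < m -> (m%:R != 0 :> K)%R.
  by have [+ _] := GRing.Theory.pcharf0P K => /(_ charK) ->; case: m.
have factor s : decomposition A s -> ordered_factorizations (ord A) (map (@ord K) s).
  move=> sA; have [s2 sG _] := sA; split; rewrite ?size_map ?(decomposition_ord sA) //.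
  by apply/(all_nthP 0) => i; rewrite size_map => lti; rewrite (nth_map (fps_Xn K 1)) //;
     have [] := sG i lti.
have [beta /(is_boettcherP natK _ GammaA)[obeta Ebeta]] := boettcher_exists natK GammaA.
(* On decompositions of A, equivalence is equality of order lists, hence reflexive, symmetric and
   transitive. *)
have equivP s t : decomposition A s -> decomposition A t ->
    equiv_decomposition s t <-> map (@ord K) s = map (@ord K) t.
  move=> sA tA; split; last exact: equiv_of_orders natK _ _ _ _ obeta Ebeta sA tA.
  move=> st; apply: (orders_of_equiv natK st); first by case: sA.
  by case: (st) => -> _; apply: decomposition_positive tA.
split=> [gamma /(is_boettcherP natK _ GammaA)[ogamma Egamma] s sA|].
  have [tA Et] := boettcher_decompositionP natK ogamma Egamma (factor s sA).
  by split=> //; apply/(equivP _ _ sA tA); rewrite Et.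
have class_self s : decomposition A s -> decomposition_class A s s.
  by move=> sA; split=> //; apply/equivP.
(* Orders of a chosen representative; the default [[::]] never arises on a class, which contains the
   decomposition defining it. *)
pose phi c := map (@ord K) (xget [::] c).
have phiE s : decomposition A s -> phi (decomposition_class A s) = map (@ord K) s.
  move=> sA; have := @xgetPex _ [::] _ (ex_intro _ s (class_self s sA)).
  by case=> tA /(equivP _ _ sA tA) ->.
exists phi; split=> //; split.
- by move=> _ [s sA <-]; rewrite phiE // -ordA; apply: factor.
(* Injectivity: by [equivP], membership in a class depends only on its order list. *)
- move=> c d /set_mem[s sA <-] /set_mem[t tA <-]; rewrite !phiE // => Est.
  apply/seteqP; split=> u [uA /equivP-/(_ _ uA) Eu]; split=> //; apply/equivP => //.
    by rewrite -Est Eu.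
  by rewrite Est Eu.
- move=> ns; rewrite -ordA => /(boettcher_decompositionP natK obeta Ebeta)[tA Et].
  by exists (decomposition_class A (boettcher_decomposition beta ns));
    [exists (boettcher_decomposition beta ns) | rewrite phiE].
Qed.
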